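(* Let $(X,d)$ be a compact metric space and let $\phi$ be a continuous flow on $X$. If $\phi$ is chain transitive, then $Sh^+(\phi)=X$ or $Sh^+(\phi)=\emptyset$.
   Context: A flow on $X$ is a map $\phi:X\times\mathbb{R}\to X$ with $\phi(x,0)=x$ and $\phi(\phi(x,s),t)=\phi(x,s+t)$, assumed continuous; $\phi_t(x)=\phi(x,t)$. Given $\delta,T>0$, a $(\delta,T)$-chain is a finite sequence $(x_i,t_i)_{i=0}^m$ in $X\times\mathbb{R}$ with $t_i\ge T$ and $d(\phi_{t_i}(x_i),x_{i+1})\le\delta$ for $0\le i\le m-1$. Points $p,q$ are $(\delta,T)$-related if there are $(\delta,T)$-chains $(x_i,t_i)_{i=0}^m$ and $(y_i,u_i)_{i=0}^n$ with $m,n\ge1$, $p=x_0=y_n$ and $q=y_0=x_m$; $p\sim q$ means they are $(\delta,T)$-related for all $\delta,T>0$. The flow is chain transitive if $p\sim q$ for all $p,q\in X$. A forward $(\delta,T)$-pseudo-orbit is a sequence $(x_i,t_i)_{i=0}^\infty$ in $X\times\mathbb{R}$ with $t_i\ge T$ and $d(\phi_{t_i}(x_i),x_{i+1})\le\delta$ for all $i\ge0$; it passes through $p$ if $x_0=p$. Put $s_0=0$, $s_i=\sum_{j=0}^{i-1}t_j$ for $i>0$, and $x_0\star t=\phi_{t-s_i}(x_i)$ whenever $s_i\le t<s_{i+1}$ ($t\ge0$). $\mathrm{Rep}$ is the set of surjective strictly increasing maps $h:\mathbb{R}\to\mathbb{R}$ with $h(0)=0$. The forward pseudo-orbit is $\varepsilon$-shadowed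 if there are $y\in X$ and $h\in\mathrm{Rep}$ with $d(x_0\star t,\phi_{h(t)}(y))\le\varepsilon$ for all $t\ge0$. $Sh^+(\phi)$ (the set of forward shadowable points) is the set of $p\in X$ such that for every $\varepsilon>0$ there is $\delta>0$ such that every forward $(\delta,1)$-pseudo-orbit passing through $p$ is $\varepsilon$-shadowed. *)

(* Defs.v *)
From HB Require Import structures.
From mathcomp Require Import all_boot all_order all_algebra.
From mathcomp Require Import all_classical all_reals.
From mathcomp Require Import topology normedtype.

Set Implicit Arguments.
Unset Strict Implicit.
Unset Printing Implicit Defensive.

Import Order.TTheory GRing.Theory Num.Theory.
Import numFieldNormedType.Exports.

Local Open Scope classical_set_scope.
Local Open Scope ring_scope.

Section Flows.
Context {R : realType} {X : metricType R}.
Implicit Types (phi : X * R -> X) (delta T eps : R) (p q y : X).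
Implicit Types (x : nat -> X) (t : nat -> R).

Definition is_flow phi : Prop :=
  [/\ forall p, phi (p, 0) = p,
      forall p (s u : R), phi (phi (p, s), u) = phi (p, s + u)
    & continuous phi].

(* The finite sequence (x_i, t_i), 0 <= i <= m, is represented by two functions
   on nat of which only the values at indices at most m are relevant. *)
Definition chain phi delta T (m : nat) x t : Prop :=
  forall i, (i < m)%N -> T <= t i /\ mdist (phi (x i, t i)) (x i.+1) <= delta.

Definition related phi delta T p q : Prop :=
  exists (m n : nat) (x : nat -> X) (t : nat -> R) (y : nat -> X) (u : nat -> R),
    [/\ (1 <= m)%N, (1 <= n)%N,
        chain phi delta T m x t, chain phi delta T n y u
      & [/\ p = x 0%N, p = y n, q = y 0%N & q = x m]].

Definition chain_equiv phi p q : Prop :=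
  forall delta T, 0 < delta -> 0 < T -> related phi delta T p q.

Definition chain_transitive phi : Prop := forall p q, chain_equiv phi p q.

Definition forward_pseudo_orbit phi delta T x t : Prop :=
  forall i, T <= t i /\ mdist (phi (x i, t i)) (x i.+1) <= delta.

Definition partial_time t (i : nat) : R := \sum_(j < i) t j.

Definition in_slot t (tau : R) (i : nat) : Prop :=
  partial_time t i <= tau < partial_time t i.+1.

(* x_0 * tau; the default index 0 is only used when no slot contains tau, which
   does not happen for tau >= 0 along a pseudo-orbit (see in_slot_ex). *)
Definition star phi x t (tau : R) : X :=
  let i := xget 0%N [set i | in_slot t tau i] in
  phi (x i, tau - partial_time t i).

Definition Rep : set (R -> R) :=
  [set h | [/\ set_surj [set: R] [set: R] h,
               {homo h : a b / a < b}
             & h 0 = 0]].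

Definition shadowed phi eps x t : Prop :=
  exists (y : X) (h : R -> R), Rep h /\
    forall tau : R, 0 <= tau -> mdist (star phi x t tau) (phi (y, h tau)) <= eps.

Definition forward_shadowable phi : set X :=
  [set p | forall eps, 0 < eps -> exists delta, 0 < delta /\
     forall x t, forward_pseudo_orbit phi delta 1 x t -> x 0%N = p ->
       shadowed phi eps x t].

Lemma partial_timeS t i : partial_time t i.+1 = partial_time t i + t i.
Proof. by rewrite /partial_time big_ord_recr. Qed.

Lemma partial_time_le t : (forall i, 0 <= t i) ->
  forall i j, (i <= j)%N -> partial_time t i <= partial_time t j.
Proof.
move=> t0 i j /subnKC <-; elim: (j - i)%N => [|k IH]; first by rewrite addn0.
by rewrite addnS partial_timeS (le_trans IH)// lerDl.
Qed.

Lemma in_slot_uniq t tau i j : (forall k, 0 <= t k) ->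
  in_slot t tau i -> in_slot t tau j -> i = j.
Proof.
move=> t0 /andP[i1 i2] /andP[j1 j2]; apply/eqP; rewrite eqn_leq; apply/andP.
by split; rewrite leqNgt; apply/negP => /(partial_time_le t0) le;
  [move: (lt_le_trans j2 le) | move: (lt_le_trans i2 le)];
  rewrite ltNge ?i1 ?j1.
Qed.

Lemma in_slot_ex T t tau : 0 < T -> (forall k, T <= t k) -> 0 <= tau ->
  exists i, in_slot t tau i.
Proof.
move=> T0 tT tau0.
have sT n : n%:R * T <= partial_time t n.
  elim: n => [|n IH]; first by rewrite mul0r /partial_time big_ord0.
  by rewrite partial_timeS -natr1 mulrDl mul1r lerD.
have ex : exists n, tau < partial_time t n.
  exists (Num.bound (tau / T)); apply: lt_le_trans (sT _).
  rewrite -ltr_pdivrMr//; apply: archi_boundP.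
  by rewrite divr_ge0// ltW.
case: (ex_minnP ex) => -[|n] ltn minn.
  by move: ltn; rewrite /partial_time big_ord0 ltNge tau0.
exists n; rewrite /in_slot ltn andbT leNgt; apply/negP => /minn.
by rewrite ltnn.
Qed.

Lemma starE phi x t tau i : (forall k, 0 <= t k) -> in_slot t tau i ->
  star phi x t tau = phi (x i, tau - partial_time t i).
Proof.
move=> t0 ti; rewrite /star; case: xgetP => [j _ tj|/(_ i)] //.
by rewrite (in_slot_uniq t0 tj ti).
Qed.

End Flows.

(* Main.v *)
Require Import Defs.
From mathcomp Require Import all_boot all_order all_algebra.
From mathcomp Require Import all_classical all_reals.
From mathcomp Require Import topology normedtype.

(** Forward shadowability propagates backwards along chains, with the same
    constant [delta].  Let [p] be forward shadowable, let [delta] be the constant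
    that [p] provides for [eps], and let [(x, t)] be a forward
    [(delta, 1)]-pseudo-orbit through [q].  Chain transitivity gives a
    [(delta, 1)]-chain from [p] to [q]; running through it and then through
    [(x, t)] is a forward [(delta, 1)]-pseudo-orbit through [p]
    ([concat_pseudo_orbit]), so some orbit shadows it.  If [S] is the total
    duration of the chain, the concatenation seen from time [S] on is [(x, t)]
    itself ([star_concat]), and the part of the shadowing orbit after time [S],
    reparametrized to start at time [0] ([Rep_shift]), shadows it.  Hence [q] is
    forward shadowable, and one shadowable point makes all points shadowable. *)

Local Open Scope classical_set_scope.

Section ShadowingAlongChains.
Import Order.TTheory GRing.Theory Num.Theory.
Local Open Scope ring_scope.

Definition concat {A : Type} (m : nat) (a b : nat -> A) (i : nat) : A :=
  if (i < m)%N then a i else b (i - m)%N.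

Lemma concat_ge (A : Type) m (a b : nat -> A) i : concat m a b (m + i) = b i.
Proof. by rewrite /concat ltnNge leq_addr addKn. Qed.

Lemma partial_time_concat (R : realType) m (u t : nat -> R) i :
  partial_time (concat m u t) (m + i) =
  partial_time (concat m u t) m + partial_time t i.
Proof.
elim: i => [|i IH]; first by rewrite addn0 {3}/partial_time big_ord0 addr0.
by rewrite addnS !partial_timeS IH concat_ge addrA.
Qed.

Section Flow.
Context {R : realType} {X : metricType R} (phi : X * R -> X).
Implicit Types (x y : nat -> X) (t u : nat -> R).

(** The junction causes no extra error because the chain ends exactly at the
    point where the pseudo-orbit starts. *)
Lemma concat_pseudo_orbit delta T m y u x t :
  chain phi delta T m y u -> forward_pseudo_orbit phi delta T x t ->
  y m = x 0%N ->
  forward_pseudo_orbit phi delta T (concat m y x) (concat m u t).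
Proof.
move=> yu xt yx i; case: (ltnP i m) => [im|/subnKC <-]; last first.
  by rewrite -addnS !concat_ge; exact: xt.
have -> : concat m y x i.+1 = y i.+1.
  rewrite /concat; case: ltnP => // mi.
  have -> : i.+1 = m by apply/eqP; rewrite eqn_leq im mi.
  by rewrite subnn.
by rewrite /concat im; exact: yu.
Qed.

Lemma star_concat T m y u x t tau : 0 < T ->
  (forall i, T <= concat m u t i) -> 0 <= tau ->
  star phi (concat m y x) (concat m u t)
    (partial_time (concat m u t) m + tau) = star phi x t tau.
Proof.
move=> T0 Tut tau0.
have Tt i : T <= t i by rewrite -(concat_ge _ m u t).
have [i ti] := in_slot_ex T0 Tt tau0.
have uti : in_slot (concat m u t) (partial_time (concat m u t) m + tau) (m + i).
  by rewrite /in_slot -addnS !partial_time_concat lerD2l ltrD2l.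
have T0' := ltW T0.
rewrite (starE _ _ _ uti) => [|k]; last exact: le_trans (Tut k).
rewrite (starE _ _ _ ti) => [|k]; last exact: le_trans (Tt k).
by rewrite partial_time_concat concat_ge opprD addrACA subrr add0r.
Qed.

Lemma Rep_shift (h : R -> R) (S : R) : Rep h -> Rep (fun a => h (S + a) - h S).
Proof.
move=> [hsurj hlt _]; split; last by rewrite addr0 subrr.
- move=> b _; have [a _ ha] := hsurj (b + h S) Logic.I.
  by exists (a - S) => //; rewrite [S + _]addrC subrK ha addrK.
- by move=> a b ab; rewrite ltrD2r; apply: hlt; rewrite ltrD2l.
Qed.

Lemma forward_shadowable_chain p q : is_flow phi -> chain_equiv phi p q ->
  forward_shadowable phi p -> forward_shadowable phi q.
Proof.
move=> [_ phiD _] pq php eps eps0; have [delta [delta0 hdelta]] := php eps eps0.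
exists delta; split=> // x t xt x0q.
have [m [_ [y [u [_ [_ [m0 _ yu _ [y0p _ _ ymq]]]]]]]] := pq delta 1 delta0 ltr01.
have yxut : forward_pseudo_orbit phi delta 1 (concat m y x) (concat m u t).
  by apply: concat_pseudo_orbit => //; rewrite -ymq.
have start : concat m y x 0%N = p by rewrite /concat m0.
have [z [h [hRep hz]]] := hdelta _ _ yxut start.
set S := partial_time (concat m u t) m.
have S0 : 0 <= S.
  by apply: sumr_ge0 => i _; apply: le_trans ler01 (yxut i).1.
exists (phi (z, h S)), (fun a => h (S + a) - h S); split; first exact: Rep_shift.
move=> tau tau0; rewrite phiD [h S + _]addrC subrK.
rewrite -(@star_concat 1 m y u) //; first exact/hz/addr_ge0.
by move=> i; have [] := yxut i.
Qed.

End Flow.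
End ShadowingAlongChains.

Theorem theorem2p11 (R : realType) (X : metricType R) (phi : X * R -> X)
    (Xcompact : compact [set: X]) (phi_flow : is_flow phi)
    (phi_transitive : chain_transitive phi) :
  forward_shadowable phi = [set: X] \/ forward_shadowable phi = set0.
Proof.
case: (pselect (exists p, forward_shadowable phi p)) => [[p php]|none].
- left; apply/seteqP; split=> // q _.
  exact: forward_shadowable_chain (phi_transitive p q) php.
- by right; apply/seteqP; split=> // p php; apply: none; exists p.
Qed.
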